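(* Let $p$ be a prime, let $F=\mathbb{Z}/p\mathbb{Z}$, let $m\geqslant 1$ be an integer, and let $S$ be a subset of $F$ with $|S|=m$. Let $A$ be a subset of $F$ with $$|A|\geqslant \sqrt{4mp+4m(m-3)+2}-m+1,$$ and put $n=\left\lfloor\frac{|A|-1+m}{2m}\right\rfloor$. Then every element of $F$ can be written in the form $a_1+\cdots+a_n$ with $a_1,\ldots,a_n\in A$ and $a_i-a_j\notin S$ for all $1\leqslant i\neq j\leqslant n$.
   Context: $|X|$ denotes the cardinality of a finite set $X$, and $\lfloor\alpha\rfloor$ denotes the greatest integer not exceeding the real number $\alpha$. *)

(* Defs.v *)
From mathcomp Require Import all_boot all_order all_algebra.
From mathcomp Require Import reals.
Set Implicit Arguments.
Unset Strict Implicit.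
Unset Printing Implicit Defensive.

(* Main.v *)
Require Import Defs.
From mathcomp Require Import all_boot all_order all_algebra.
From mathcomp Require Import reals zify lra.
Set Implicit Arguments.
Unset Strict Implicit.
Unset Printing Implicit Defensive.
Import Order.TTheory GRing.Theory Num.Theory.
Local Open Scope ring_scope.

(** The proof is by the polynomial method. Write [k = #|A|], fix a target [c],
and suppose that [c] is not a sum of the required kind. The polynomial

  P(x) = prod_(d <> 0) (sum_i x_i - (c + d))
         * prod_(i <> j) prod_(s in S) (x_i - x_j - s)

then vanishes on the whole of [A^n]: a point of [A^n] either has some
difference in [S] or has a coordinate sum different from [c]. Its degree is
[p - 1 + m n (n - 1)], which the hypothesis on [k] makes at most [n (k - 1)]
([size_condition]). So one can choose degrees [K_i < k] that add up to it, and
subsets [A'_i] of [A] with [K_i + 1] elements.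

For a polynomial of degree at most [sum_i K_i], the coefficient of
[prod_i x_i ^ K_i] is a combination of the values on any grid of sides
[K_i + 1], with nonzero Lagrange weights. For a product of affine forms this
coefficient does not involve the constant terms ([grid_sum]). On the grid of
the [A'_i] it is therefore zero, and it must remain zero after the constants
of [P] are changed and the grid is replaced by another one of the same sides.

To contradict this, replace [c] by [c_0 = sum_(i < n) m i], the roots [S] of
the factors in [x_i - x_j] by [1, ..., m] when [i < j] and by
[0, ..., m - 1] when [i > j], and the grid by the product of the intervals
[{0, ..., K_i}]. At a point of this grid where the new polynomial does not
vanish, the coordinates, seen as natural numbers, have mutual distances at
least [m]. Hence their sum is at least [c_0]; the same bound applied to the
[K_i - x_i] shows that it is at most [c_0 + p - 1]. Being congruent to [c_0]
modulo [p], it equals [c_0], so the coordinates are [0, m, 2 m, ...] in some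
order, and the asymmetry between [i < j] and [i > j] leaves only
[x_i = m i] ([skew_spaced_box]). Exactly one term of the sum over the grid is
nonzero ([prod_skew_factor_neq0]), so the coefficient is not zero. This
avoids evaluating it: it is a Dyson-type coefficient of
[(sum_i x_i) ^ (p - 1) * prod_(i < j) (x_i - x_j) ^ (2 m)]. *)

(** * Coefficients as weighted sums over a grid *)

Definition lagrange_weight (F : finFieldType) (B : {set F}) (b : F) : F :=
  (\prod_(c in B :\ b) (b - c))^-1.

Lemma lagrange_weight_neq0 (F : finFieldType) (B : {set F}) (b : F) :
  lagrange_weight B b != 0.
Proof.
rewrite invr_neq0 //; apply/prodf_neq0 => c; rewrite !inE => /andP[cb _].
by rewrite subr_eq0 eq_sym.
Qed.

(** The sum is the coefficient of [X^k] in the Lagrange interpolant of [X^j]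
at the points of [B]; as [j < #|B|], this interpolant is [X^j] itself. *)
Lemma sum_lagrange_weight_exp (F : finFieldType) (B : {set F}) (k j : nat) :
    #|B| = k.+1 -> (j <= k)%N ->
  \sum_(b in B) lagrange_weight B b * b ^+ j = (j == k)%:R.
Proof.
move=> cardB le_jk.
pose N b : {poly F} := \prod_(c in B :\ b) ('X - c%:P).
have cardD1 b : b \in B -> #|B :\ b| = k.
  by move=> bB; apply: succn_inj; rewrite -cardB (cardsD1 b B) bB.
have sizeN b : b \in B -> size (N b) = k.+1.
  by move=> bB; rewrite /N -big_enum size_prod_XsubC -cardE cardD1.
have lcN b : b \in B -> (N b)`_k = 1.
  move=> bB; have := monic_prod_XsubC (index_enum F) (mem (B :\ b)) id.
  by rewrite monicE lead_coefE -/(N b) sizeN // => /eqP.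
pose q := \sum_(b in B) (lagrange_weight B b * b ^+ j) *: N b - 'X^j.
(* [q] has size at most [#|B|] and vanishes on [B]. *)
suff q0 : q = 0.
  transitivity (('X^j : {poly F})`_k); last by rewrite coefXn eq_sym.
  rewrite -['X^j]add0r -q0 subrK coef_sum; apply: eq_bigr => b bB.
  by rewrite coefZ lcN // mulr1.
apply: (@roots_geq_poly_eq0 F q (enum B)).
- apply/allP => a; rewrite mem_enum => aB.
  rewrite /root /q hornerD hornerN horner_sum hornerXn subr_eq0; apply/eqP.
  rewrite (bigD1 a) //= big1 ?addr0 => [|b /andP[bB ba]].
    rewrite hornerZ horner_prod.
    under [X in _ * X]eq_bigr do rewrite hornerXsubC.
    by rewrite mulrAC mulVf ?mul1r // -invr_eq0 lagrange_weight_neq0.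
  rewrite hornerZ horner_prod (bigD1 a) ?inE ?[a == b]eq_sym ?ba //=.
  by rewrite hornerXsubC subrr mul0r mulr0.
- exact: enum_uniq.
rewrite -cardE cardB /q (leq_trans (size_polyD _ _)) // geq_max size_polyN.
rewrite size_polyXn ltnS le_jk andbT.
apply/(leq_trans (size_sum _ _ _))/bigmax_leqP => b bB.
by rewrite (leq_trans (size_scale_leq _ _)) // sizeN.
Qed.

Lemma sum_option (V : nmodType) (I : finType) (f : option I -> V) :
  \sum_o f o = f None + \sum_i f (Some i).
Proof.
rewrite (bigD1 None) //= (reindex_omap (@Some I) id) /=; last by case.
by congr (_ + _); apply: eq_bigl => i; rewrite eqxx.
Qed.

(** The fibres of [h] over the [Some i] are disjoint and miss exactly the
points sent to [None]. *)
Lemma sum_fiber_leq (T I : finType) (h : T -> option I) :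
  (\sum_i #|[pred t | h t == Some i]|
     <= #|T| ?= iff [forall t, h t != None])%N.
Proof.
have -> : (\sum_i #|[pred t | h t == Some i]| = \sum_t (h t != None))%N.
  under eq_bigr do rewrite -sum1_card big_mkcond.
  rewrite exchange_big; apply: eq_bigr => t _.
  under eq_bigr do rewrite inE.
  case: (h t) => [i|] /=; last by rewrite big1.
  rewrite (bigD1 i) //= eqxx big1 // => j ji.
  by rewrite (inj_eq (@Some_inj _)) eq_sym (negbTE ji).
rewrite -sum1_card.
by apply: leqif_sum => t _; split; [apply: leq_b1 | case: (h t != None)].
Qed.

(** Both sides are the coefficient of [prod_i x_i ^ K i] in the product of the
affine forms [sum_i u t i * x i - c t]. What matters is that the right-hand
side contains neither the grid [B] nor the constants [c]: both may be changed
freely. Expanding the product, [h t] tells which term is picked in the factor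
[t], with [None] standing for the constant; a monomial of exponents [e] has
degree at most [sum_i K i], so either [e = K], which leaves no room for a
constant, or some [e i < K i] and the weighted sum along that coordinate is
zero. *)
Lemma grid_sum (F : finFieldType) (I T : finType) (B : I -> {set F})
    (K : I -> nat) (u : T -> I -> F) (c : T -> F) :
    (forall i, #|B i| = (K i).+1) -> #|T| = (\sum_i K i)%N ->
  \sum_(x in family (fun i => mem (B i)))
     (\prod_i lagrange_weight (B i) (x i)) *
     (\prod_t (\sum_i u t i * x i - c t)) =
  \sum_(h : {ffun T -> option I} |
          [forall i, #|[pred t | h t == Some i]| == K i])
     \prod_t oapp (u t) 0 (h t).
Proof.
move=> cardB cardT.
pose cf t o := oapp (u t) (- c t) o.
pose e (h : {ffun T -> option I}) i := #|[pred t | h t == Some i]|.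
have expand (x : {ffun I -> F}) :
    \prod_t (\sum_i u t i * x i - c t) =
    \sum_(h : {ffun T -> option I}) (\prod_t cf t (h t)) * \prod_i x i ^+ e h i.
  transitivity (\prod_t \sum_o (cf t o * oapp x 1 o)).
    by apply: eq_bigr => t _; rewrite sum_option /= mulr1 addrC.
  rewrite bigA_distr_bigA; apply: eq_bigr => h _; rewrite big_split /=.
  congr (_ * _).
  rewrite (eq_bigr (fun t => \prod_i (if h t == Some i then x i else 1))).
    rewrite exchange_big; apply: eq_bigr => i _.
    by rewrite -big_mkcond prodr_const.
  move=> t _; case: (h t) => [i|] /=; last by rewrite big1.
  rewrite (bigD1 i) //= eqxx big1 ?mulr1 // => j ji.
  by rewrite (inj_eq (@Some_inj _)) eq_sym (negbTE ji).
under eq_bigr do rewrite expand mulr_sumr.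
rewrite exchange_big [RHS]big_mkcond; apply: eq_bigr => h _ /=.
under eq_bigr do rewrite mulrCA -big_split /=.
rewrite -mulr_sumr.
rewrite -(bigA_distr_big_dep _ (fun i b => lagrange_weight (B i) b * b ^+ e h i)).
have [le_e eq_e] := sum_fiber_leq h; rewrite -/(e h) in le_e eq_e.
case: ifPn => [/forallP eK | /forallPn[i0 ne_i0]].
  rewrite [X in _ * X]big1 ?mulr1 => [|i _]; last first.
    have eKi : e h i = K i := eqP (eK i).
    by rewrite (sum_lagrange_weight_exp (cardB i)) eKi ?eqxx.
  apply: eq_bigr => t _; rewrite /cf; case E: (h t) => //=.
  have /eqP := cardT; rewrite eq_sym -(eq_bigr _ (fun i _ => eqP (eK i))) eq_e.
  by move=> /forallP/(_ t); rewrite E.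
(* As [e h] differs from [K] and its sum is no larger, it is smaller somewhere. *)
have [i lt_i] : exists i, (e h i < K i)%N.
  apply/existsP; apply: contraR ne_i0 => /existsPn ge_e.
  have leK i : true -> (K i <= e h i ?= iff (K i == e h i))%N.
    by move=> _; apply/leqif_eq; rewrite leqNgt ge_e.
  have [leKs eqKs] := leqif_sum leK.
  have : (\sum_i K i)%N == (\sum_i e h i)%N.
    by rewrite eqn_leq leKs -cardT le_e.
  by rewrite eqKs => /forallP/(_ i0); rewrite /= eq_sym.
rewrite [X in _ * X](bigD1 i) //= (sum_lagrange_weight_exp (cardB i)) ?(ltnW lt_i) //.
by rewrite (ltn_eqF lt_i) mul0r mulr0.
Qed.

(** * Spaced configurations of natural numbers *)

Definition spaced (I : Type) (m : nat) (x : I -> nat) :=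
  forall i j, i <> j -> (x i + m <= x j \/ x j + m <= x i)%N.

Definition rank (I : finType) (x : I -> nat) (i : I) : nat :=
  #|[pred j | (x j < x i)%N]|.

Lemma spaced_inj (I : eqType) (m : nat) (x : I -> nat) :
  (0 < m)%N -> spaced m x -> injective x.
Proof.
by move=> m_gt0 sp i j xij; case: (eqVneq i j) => // /eqP/sp; rewrite xij; lia.
Qed.

(** Each pair of distinct indices contributes to the rank of exactly one of its
two members. *)
Lemma sum_rank (I : finType) (x : I -> nat) :
  injective x -> (2 * (\sum_i rank x i) + #|I| = #|I| ^ 2)%N.
Proof.
move=> injx.
have rankE i : rank x i = (\sum_j (x j < x i))%N.
  by rewrite /rank -sum1_card big_mkcond; apply: eq_bigr => j _; rewrite inE.
under eq_bigr do rewrite rankE.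
rewrite mul2n -addnn {2}exchange_big /= -big_split /= -{1}sum1_card -big_split /=.
rewrite -mulnn -sum_nat_const; apply: eq_bigr => i _.
rewrite -big_split /= -sum1_card (bigD1 i) //= ltnn add0n addnC [RHS](bigD1 i) //=.
congr (_ + _)%N; apply: eq_bigr => j ji.
have : x j <> x i by move/injx/eqP; rewrite (negbTE ji).
lia.
Qed.

(** The quotients by [m] of spaced values are distinct, so that [rank x i] of
them are smaller than [x i %/ m]. *)
Lemma spaced_rank_leq (I : finType) (m : nat) (x : I -> nat) :
  (0 < m)%N -> spaced m x -> forall i, (m * rank x i <= x i)%N.
Proof.
move=> m_gt0 sp i.
suff le_q : (rank x i <= x i %/ m)%N.
  by rewrite (leq_trans _ (leq_divM (x i) m)) // mulnC leq_mul2r le_q orbT.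
have injq : {in [pred j | (x j < x i)%N] &, injective (fun j => x j %/ m)%N}.
  move=> j l _ _ eq_q; apply/eqP/negP => /negP/eqP/sp.
  have := divn_eq (x j) m; have := divn_eq (x l) m.
  have := ltn_pmod (x j) m_gt0; have := ltn_pmod (x l) m_gt0; rewrite eq_q; lia.
rewrite /rank cardE -(size_map (fun j => x j %/ m)%N).
rewrite -[leqRHS](size_iota 0); apply: uniq_leq_size => [|q].
  by rewrite map_inj_in_uniq ?enum_uniq // => j l; rewrite !mem_enum; apply: injq.
case/mapP=> j; rewrite mem_enum inE => ltji ->; rewrite mem_iota /= add0n.
have ji : j <> i by move=> eji; rewrite eji ltnn in ltji.
have : (x j + m <= x i)%N by have := sp j i ji; lia.
by move/(leq_div2r m); rewrite divnDr // divnn m_gt0 addn1.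
Qed.

Lemma sum_ord (n : nat) : (2 * (\sum_(i < n) i) + n = n ^ 2)%N.
Proof.
rewrite -mulnn; elim: n => [|n]; rewrite ?big_ord0 // big_ord_recr /=.
by set s := bigop _ _ _; rewrite -/s; lia.
Qed.

(** Spaced values have at least the sum of [0, m, 2 m, ...]; the equality case
is kept in terms of ranks, since the order of the values is still free. *)
Lemma sum_spaced_geq (n m : nat) (x : 'I_n -> nat) :
  (0 < m)%N -> spaced m x ->
  (\sum_(i < n) m * i <= \sum_i x i ?= iff [forall i, m * rank x i == x i])%N.
Proof.
move=> m_gt0 sp.
have -> : (\sum_(i < n) m * i = \sum_(i < n) m * rank x i)%N.
  rewrite -!big_distrr /=; congr (_ * _)%N.
  have := sum_rank (spaced_inj m_gt0 sp); rewrite card_ord -sum_ord.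
  by move/addIn/eqP; rewrite eqn_mul2l => /eqP->.
by apply: leqif_sum => i _; apply/leqif_eq/spaced_rank_leq.
Qed.

(** The strict inequality on one side makes inversions expensive: it is what
singles out one ordering among the tightly packed configurations. *)
Definition skew_spaced (n m : nat) (x : 'I_n -> nat) :=
  forall i j : 'I_n, (i < j)%N -> (x i + m <= x j \/ x j + m < x i)%N.

Lemma skew_spacedW (n m : nat) (x : 'I_n -> nat) :
  skew_spaced m x -> spaced m x.
Proof.
move=> sk i j /eqP; rewrite -val_eqE neq_ltn => /orP[] /sk; lia.
Qed.

(** When the sum is minimal the values are [0, m, 2 m, ...] in some order, and
consecutive ones differ by exactly [m], which skewness only allows in the index
order. So the indices increase along the values, hence are the ranks. *)
Lemma skew_spaced_min (n m : nat) (x : 'I_n -> nat) :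
    (0 < m)%N -> skew_spaced m x -> (\sum_i x i = \sum_(i < n) m * i)%N ->
  forall i : 'I_n, x i = (m * i)%N.
Proof.
move=> m_gt0 sk sumx; have sp := skew_spacedW sk.
have [_ /esym] := sum_spaced_geq m_gt0 sp; rewrite sumx eqxx => /forallP xE.
have {}xE i : x i = (m * rank x i)%N by rewrite (eqP (xE i)).
have rank_lt i : (rank x i < n)%N.
  rewrite -[X in (_ < X)%N]card_ord; apply: proper_card.
  by apply/properP; split; [apply/subsetP | exists i; rewrite ?inE ?ltnn].
have rank_inj : injective (fun i => Ordinal (rank_lt i)).
  move=> i j [rij]; apply: (spaced_inj m_gt0 sp).
  by rewrite xE [in RHS]xE rij.
have rank_le i : (rank x i <= i)%N.
  have [v] := ubnP (rank x i); elim: v i => // v IHv i; rewrite ltnS => rv.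
  case: (posnP (rank x i)) => [->//|r_gt0].
  have lt_r1 : ((rank x i).-1 < n)%N by rewrite (leq_ltn_trans (leq_pred _)).
  have /codomP[j /(congr1 val) /= rj] := injF_onto rank_inj (Ordinal lt_r1).
  have rS : rank x i = (rank x j).+1 by rewrite -rj prednK.
  have le_j : (rank x j <= j)%N by apply: IHv; rewrite -ltnS -rS.
  have : x i = (x j + m)%N by rewrite (xE i) (xE j) rS mulnS addnC.
  have : i <> j by move=> eij; rewrite eij in rS; lia.
  by move/eqP; rewrite -val_eqE neq_ltn => /orP[/sk|] /=; lia.
(* Ranks and indices have the same sum, so the inequalities are equalities. *)
have rE i : rank x i = i.
  have leR i' : true -> (rank x i' <= i' ?= iff (rank x i' == i'))%N.
    by move=> _; apply/leqif_eq.
  have [_] := leqif_sum leR.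
  have -> : (\sum_(i < n) rank x i = \sum_(i < n) i)%N.
    move: sumx; under eq_bigr do rewrite xE.
    by rewrite -!big_distrr /= => /eqP; rewrite eqn_mul2l gtn_eqF //= => /eqP.
  by rewrite eqxx => /esym/forallP/(_ i)/eqP.
by move=> i; rewrite xE rE.
Qed.

(** Besides [x], its reflection [K - x] in the box is spaced: the strict
inequality in skewness absorbs the steps of at most 1 in [K]. The lower bound
on sums, applied to both, confines the sum of [x] to a range of [p] consecutive
values, where its class modulo [p] determines it. *)
Lemma skew_spaced_box (n m p : nat) (x K : 'I_n -> nat) :
    (0 < m)%N -> skew_spaced m x ->
    (forall i, x i <= K i)%N ->
    (forall i j : 'I_n, (i < j)%N -> (K j <= K i <= (K j).+1)%N) ->
    (\sum_i K i < 2 * (\sum_(i < n) m * i) + p)%N ->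
    (\sum_i x i = \sum_(i < n) m * i %[mod p])%N ->
  forall i : 'I_n, x i = (m * i)%N.
Proof.
move=> m_gt0 sk leK stepK sumK modp; apply: skew_spaced_min => //.
have [lo _] := sum_spaced_geq m_gt0 (skew_spacedW sk).
have spy : spaced m (fun i => K i - x i)%N.
  move=> i j /eqP; rewrite -val_eqE neq_ltn => /orP[] ltij.
    have := sk _ _ ltij; have := stepK _ _ ltij; have := leK i; have := leK j; lia.
  have := sk _ _ ltij; have := stepK _ _ ltij; have := leK i; have := leK j; lia.
have [hi _] := sum_spaced_geq m_gt0 spy.
have sumKE : (\sum_i K i = \sum_i (K i - x i) + \sum_i x i)%N.
  by rewrite -big_split; apply: eq_bigr => i _; rewrite /= subnK.
have lt_p : (\sum_i x i - \sum_(i < n) m * i < p)%N.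
  by move: lo hi sumK; rewrite sumKE; lia.
have dv : (p %| \sum_i x i - \sum_(i < n) m * i)%N.
  by rewrite -eqn_mod_dvd //; apply/eqP.
apply/eqP; rewrite eqn_leq lo andbT -subn_eq0 eqn0Ngt; apply/negP => gt0.
by have := dvdn_leq gt0 dv; rewrite leqNgt lt_p.
Qed.

(** * The product of affine forms *)

(** The index type of the factors of both polynomials compared in the proof:
a left summand is a factor in [sum_i x i], a right one a factor in
[x i - x j]. The two polynomials have the same [slope] and different
[intercept]. *)
Definition factor (F : finFieldType) (n m : nat) : finType :=
  ({d : F | d != 0} + {ij : 'I_n * 'I_n | ij.1 != ij.2} * 'I_m)%type.

Definition slope (F : finFieldType) (n m : nat) (t : factor F n m) (i : 'I_n) : F :=
  match t with
  | inl _ => 1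
  | inr (ij, _) => (i == (val ij).1)%:R - (i == (val ij).2)%:R
  end.

Definition intercept (F : finFieldType) (n m : nat) (c : F)
    (f : 'I_n -> 'I_n -> 'I_m -> F) (t : factor F n m) : F :=
  match t with
  | inl d => c + val d
  | inr (ij, s) => f (val ij).1 (val ij).2 s
  end.

Lemma card_factor (F : finFieldType) (n m : nat) :
  #|factor F n m| = (#|F|.-1 + m * (n * n.-1))%N.
Proof.
rewrite card_sum card_sig card_prod card_sig card_ord cardC1; congr (_ + _)%N.
rewrite mulnC; congr (_ * _)%N.
have := cardC [pred ij : 'I_n * 'I_n | ij.1 == ij.2].
rewrite card_prod !card_ord.
have -> : #|[pred ij : 'I_n * 'I_n | ij.1 == ij.2]| = n.
  rewrite -[RHS]card_ord -(card_codom (f := fun i : 'I_n => (i, i)));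
    last by move=> i j [].
  apply: eq_card => -[i j]; rewrite inE /=.
  by apply/eqP/codomP => [->|[k [-> ->]]] //; exists j.
move=> E; rewrite -subn1 mulnBr muln1 -[in RHS]E addKn.
by apply: eq_card => ij; rewrite !inE.
Qed.

Lemma prod_factor_neq0 (F : finFieldType) (n m : nat) (c : F)
    (f : 'I_n -> 'I_n -> 'I_m -> F) (x : 'I_n -> F) :
  reflect (\sum_i x i = c /\ forall i j s, i != j -> x i - x j != f i j s)
    (\prod_(t : factor F n m) (\sum_i slope t i * x i - intercept c f t) != 0).
Proof.
have evl d : \sum_i slope (inl d : factor F n m) i * x i = \sum_i x i.
  by apply: eq_bigr => i _; rewrite mul1r.
have sel k : \sum_i (i == k)%:R * x i = x k.
  rewrite (bigD1 k) //= eqxx mul1r big1 ?addr0 // => i /negbTE->.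
  by rewrite mul0r.
have evr ij s : \sum_i slope (inr (ij, s) : factor F n m) i * x i
                = x (val ij).1 - x (val ij).2.
  by under eq_bigr do rewrite mulrBl; rewrite sumrB !sel.
apply: (iffP (prodf_neq0 _ _)) => [nz|[sumx dif] [d|[[[i j] ij] s]] _].
- split=> [|i j s ij].
    apply/eqP; rewrite -subr_eq0; apply/negPn/negP => d_neq0.
    have := nz (inl (exist (fun d => d != 0) _ d_neq0)) isT.
    by rewrite evl /= [c + _]addrC subrK subrr eqxx.
  have := nz (inr (exist (fun ij => ij.1 != ij.2) (i, j) ij, s)) isT.
  by rewrite evr /= subr_eq0.
- by rewrite evl sumx /= opprD addrA subrr add0r oppr_eq0 (valP d).
- by rewrite evr /= subr_eq0 dif.
Qed.

(** * Comparing two grids in a prime field *)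

Lemma sum_ord_lt (n r : nat) : (\sum_(i < n) (i < r) = minn r n)%N.
Proof.
elim: n => [|n]; first by rewrite big_ord0 minn0.
by rewrite big_ord_recr /= => ->; case: (ltnP n r); lia.
Qed.

Lemma exists_subset_card (T : finType) (A : {set T}) (k : nat) :
  (k <= #|A|)%N -> exists2 B : {set T}, B \subset A & #|B| = k.
Proof.
move=> le_k; exists [set x in take k (enum A)].
  by apply/subsetP => x; rewrite inE => /mem_take; rewrite mem_enum.
rewrite cardsE (card_uniqP _) ?size_takel -?cardE //.
exact: (take_uniq _ (enum_uniq _)).
Qed.

Lemma Fp_natr_inj (p : nat) (hp : prime p) (a b : nat) :
  a%:R = b%:R :> 'F_p -> a = b %[mod p].
Proof. by move/(congr1 val); rewrite /= !val_Fp_nat. Qed.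

Definition Fp_segment (p k : nat) : {set 'F_p} :=
  [set (t : nat)%:R | t : 'I_k.+1].

Lemma Fp_segmentP (p k : nat) (hp : prime p) (b : 'F_p) :
  (k < p)%N -> (b \in Fp_segment p k) = (val b <= k)%N.
Proof.
move=> lt_kp; apply/imsetP/idP => [[t _ ->]|le_bk].
  by rewrite /= val_Fp_nat // modn_small; have := ltn_ord t; lia.
by exists (Ordinal (le_bk : (val b < k.+1)%N)); rewrite //= natr_Zp.
Qed.

Lemma card_Fp_segment (p k : nat) (hp : prime p) :
  (k < p)%N -> #|Fp_segment p k| = k.+1.
Proof.
move=> lt_kp; rewrite card_imset ?card_ord // => s t /(Fp_natr_inj hp).
by rewrite !modn_small; [move/val_inj | have := ltn_ord t; lia | have := ltn_ord s; lia].
Qed.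

(** For [i < j] the factors in [x i - x j] and [x j - x i] exclude
[x i - x j = 1, ..., m] and [x j - x i = 0, ..., m - 1], which is
[skew_spaced]. Conversely no factor vanishes at [x i = m i] because all the
integers involved are at most [m n < p]. *)
Lemma prod_skew_factor_neq0 (p : nat) (hp : prime p) (n m : nat)
    (K : 'I_n -> nat) (x : {ffun 'I_n -> 'F_p}) :
    (0 < m)%N -> (m * n < p)%N -> (forall i, K i < p)%N ->
    (forall i j : 'I_n, (i < j)%N -> (K j <= K i <= (K j).+1)%N) ->
    (\sum_i K i = p.-1 + m * (n * n.-1))%N ->
    (forall i, x i \in Fp_segment p (K i)) ->
  (\prod_(t : factor 'F_p n m)
     (\sum_i slope t i * x i -
      intercept (\sum_(i < n) m * i)%N%:R (fun i j s => (s + (i < j))%N%:R) t) != 0)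
  = (x == [ffun i : 'I_n => (m * i)%N%:R]).
Proof.
move=> m_gt0 lt_mn ltK stepK sumK xB.
apply/prod_factor_neq0/eqP => [[sumx difx]|->]; last first.
  split=> [|i j s ij]; first by rewrite natr_sum; apply: eq_bigr => i _; rewrite ffunE.
  rewrite !ffunE subr_eq -natrD; apply/eqP => /(Fp_natr_inj hp).
  have := ltn_ord i; have := ltn_ord j; have := ltn_ord s => lts ltj lti.
  rewrite !modn_small; [|nia|nia].
  by move: ij; rewrite -val_eqE neq_ltn => /orP[] /= ltij; nia.
pose v i : nat := val (x i).
have xE i : x i = (v i)%:R by rewrite natr_Zp.
suff vE i : v i = (m * i)%N by apply/ffunP => i; rewrite ffunE -vE.
apply: (@skew_spaced_box n m p v K m_gt0) => //.
- move=> {}i j ltij.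
  have ne_ij : i != j by rewrite -val_eqE ltn_eqF.
  case: (leqP (v i + m) (v j)) => [|lt1]; [by left|right].
  case: (ltnP (v j + m) (v i)) => // le2; exfalso.
  case: (leqP (v i) (v j)) => [le3|lt3].
    have lts : (v j - v i < m)%N by lia.
    have := difx j i (Ordinal lts); rewrite eq_sym ne_ij => /(_ isT).
    by rewrite !xE /= ltnNge (ltnW ltij) addn0 natrB // eqxx.
  have lts : (v i - v j - 1 < m)%N by lia.
  have := difx i j (Ordinal lts) ne_ij.
  by rewrite !xE /= ltij subnK ?natrB ?eqxx // ?subn_gt0 // ltnW.
- by move=> {}i; rewrite -Fp_segmentP.
- rewrite sumK -big_distrr /=; have := sum_ord n; have := prime_gt0 hp.
  set s := bigop _ _ _; nia.
- apply: (Fp_natr_inj hp); rewrite -sumx natr_sum.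
  by apply: eq_bigr => j _; rewrite xE.
Qed.

(** The coefficient computed on subsets of [A] is the one computed on initial
segments; the latter reduces to one nonzero term, so some point of [A^n] makes
the product nonzero, which is what is sought. *)
Lemma restricted_sums_cover (p : nat) (hp : prime p) (n m : nat)
    (S A : {set 'F_p}) :
    #|S| = m -> (0 < m)%N -> (m * n < p)%N ->
    (p.-1 + m * (n * n.-1) <= n * #|A|.-1)%N ->
  forall c : 'F_p, exists a : 'I_n -> 'F_p,
    [/\ forall i, a i \in A,
        forall i j, i != j -> a i - a j \notin S
      & \sum_i a i = c].
Proof.
move=> cardS m_gt0 lt_mn le_A c.
set T := (p.-1 + m * (n * n.-1))%N in le_A.
have p_gt1 := prime_gt1 hp.
have n_gt0 : (0 < n)%N by move: le_A; rewrite /T; case: (n) => //; lia.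
have A_gt1 : (1 < #|A|)%N.
  by move: le_A; rewrite /T; case: #|A| => [|[|k]] //=; rewrite muln0; lia.
(* The degree [T] is spread as evenly as possible, larger parts first, as the
   step condition of [skew_spaced_box] requires. *)
pose K (i : 'I_n) := (T %/ n + (i < T %% n))%N.
have sumK : (\sum_i K i = T)%N.
  rewrite big_split /= sum_nat_const card_ord sum_ord_lt.
  have lt_r := ltn_pmod T n_gt0.
  by rewrite (minn_idPl (ltnW lt_r)) mulnC -divn_eq.
have ltKA i : (K i < #|A|)%N.
  move: le_A; rewrite {1}(divn_eq T n) [(n * _)%N]mulnC /K.
  case: (ltnP i (T %% n)%N) => /= r_i le_A.
    have lt_q : (T %/ n < #|A|.-1)%N.
      rewrite -(ltn_pmul2r n_gt0); apply: leq_trans le_A.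
      by rewrite -addn1 leq_add2l (leq_ltn_trans _ r_i).
    by rewrite addn1 (leq_ltn_trans lt_q) // ltn_predL ltnW.
  have le_q : (T %/ n <= #|A|.-1)%N.
    by rewrite -(leq_pmul2r n_gt0) (leq_trans (leq_addr _ _) le_A).
  by rewrite addn0 (leq_ltn_trans le_q) // ltn_predL ltnW.
have cardAp : (#|A| <= p)%N by rewrite -[leqRHS](card_Fp hp) max_card.
have ltKp i : (K i < p)%N by apply: leq_trans (ltKA i) cardAp.
have stepK (i j : 'I_n) : (i < j)%N -> (K j <= K i <= (K j).+1)%N.
  by rewrite /K; case: ltnP; case: ltnP; lia.
have geK (i : 'I_n) : (m * i <= K i)%N.
  apply: leq_trans (leq_addr _ _); rewrite leq_divRL //.
  have := ltn_ord i; rewrite /T; nia.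
have /fin_all_exists2[A' subA' cardA'] : forall i,
    exists2 B : {set 'F_p}, B \subset A & #|B| = (K i).+1.
  by move=> i; apply: exists_subset_card.
pose f (i j : 'I_n) (s : 'I_m) := nth 0 (enum S) s.
have cardF : #|factor 'F_p n m| = (\sum_i K i)%N.
  by rewrite card_factor card_Fp // sumK.
have cardB i := card_Fp_segment hp (ltKp i).
pose y := [ffun i : 'I_n => (m * i)%N%:R : 'F_p].
have yB i : y i \in Fp_segment p (K i).
  rewrite ffunE Fp_segmentP //= val_Fp_nat //.
  by rewrite (leq_trans (leq_mod _ _)).
pose g (i j : 'I_n) (s : 'I_m) : 'F_p := (s + (i < j))%N%:R.
have prod_g_neq0 x := @prod_skew_factor_neq0 p hp n m K x m_gt0 lt_mn ltKp stepK sumK.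
have sumQ_neq0 := grid_sum (@slope _ n m)
  (intercept (\sum_(i < n) m * i)%N%:R g) cardB cardF.
rewrite -(grid_sum (@slope _ n m) (intercept c f) cardA' cardF) in sumQ_neq0.
rewrite (bigD1 y) /= in sumQ_neq0; last by apply/familyP.
rewrite [X in _ + X]big1 ?addr0 in sumQ_neq0; last first.
  move=> x /andP[/familyP xB xy]; apply/eqP; rewrite mulf_eq0; apply/orP; right.
  by apply: contraNT xy; rewrite prod_g_neq0.
have {sumQ_neq0} : \sum_(x in family (fun i => mem (A' i)))
     (\prod_i lagrange_weight (A' i) (x i)) *
     (\prod_t (\sum_i slope t i * x i - intercept c f t)) != 0.
  rewrite -sumQ_neq0 mulf_neq0 //; last by rewrite prod_g_neq0.
  by apply/prodf_neq0 => i _; apply: lagrange_weight_neq0.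
have [[x /andP[/familyP xA nz]] _|all0] := altP (@existsP _
   (fun x : {ffun 'I_n -> 'F_p} =>
   (x \in family (fun i => mem (A' i))) &&
   (\prod_t (\sum_i slope t i * x i - intercept c f t) != 0))); last first.
  rewrite big1 ?eqxx // => x xA.
  move/existsPn/(_ x): all0; rewrite xA /= negbK => /eqP->.
  by rewrite mulr0.
have [sumx difx] := elimT (prod_factor_neq0 _ _ _) nz.
exists x; split=> // [i|i j ij]; first exact: (subsetP (subA' i)).
apply/negP => xS; have lts : (index (x i - x j)%R (enum S) < m)%N.
  by rewrite -cardS cardE index_mem mem_enum.
by have := difx i j (Ordinal lts) ij; rewrite /f nth_index ?mem_enum ?eqxx.
Qed.

(** * The numerical condition *)

(** Write [a + m - 1 = 2 m n + r] with [r < 2 m]. The second conclusion is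
[p - 1 <= m n^2 + r n], and [4 m (m n^2 + r n) = (a + m - 1)^2 - r^2], which by
hypothesis and [r <= 2 m - 1] exceeds [4 m (p - 2)]. *)
Lemma size_condition (R : realType) (p m a n : nat) :
    (1 < p)%N -> (0 < m)%N -> (m <= p)%N -> (a <= p)%N ->
    Num.sqrt (4 * m%:R * p%:R + 4 * m%:R * (m%:R - 3) + 2) - m%:R + 1
      <= a%:R :> R ->
    n%:Z = Num.floor ((a%:R - 1 + m%:R) / (2 * m%:R) : R) ->
  (m * n < p)%N /\ (p.-1 + m * (n * n.-1) <= n * a.-1)%N.
Proof.
move=> p_gt1 m_gt0 le_mp le_ap hA hn.
have m_pos : (0 : R) < 2 * m%:R by rewrite -natrM ltr0n muln_gt0.
have /andP[] := floor_itv ((a%:R - 1 + m%:R) / (2 * m%:R) : R).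
rewrite -hn ler_pdivlMr // ltr_pdivrMr //.
rewrite intrD -!pmulrn => lo hi.
have {}lo : (2 * (m * n) + 1 <= a + m)%N.
  rewrite -(ler_nat R) !natrD !natrM; lra.
have {}hi : (a + m < 2 * (m * n) + 2 * m + 1)%N.
  rewrite -(ltr_nat R) !natrD !natrM; lra.
have sq : (4 * (m * p) + 4 * (m * m) + 2 <= (a + m - 1) ^ 2 + 12 * m)%N.
  set X := (X in Num.sqrt X) in hA.
  have le_sqrt : Num.sqrt X <= a%:R + m%:R - 1 by lra.
  have : X <= (a%:R + m%:R - 1) ^+ 2.
    apply: (@le_trans _ _ (Num.sqrt X ^+ 2)).
      case: (lerP 0 X) => [X0|/ltW X0]; first by rewrite sqr_sqrtr.
      exact: le_trans X0 (sqr_ge0 _).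
    by rewrite lerXn2r ?nnegrE ?sqrtr_ge0 // (le_trans (sqrtr_ge0 _) le_sqrt).
  rewrite -(ler_nat R) !natrD !natrX natrB ?addn_gt0 ?m_gt0 ?orbT // !natrD !natrM.
  rewrite /X; lra.
have lt_mn : (m * n < p)%N by lia.
split=> //.
have [r rE] : exists r, (a + m - 1 = 2 * (m * n) + r)%N.
  by exists (a + m - 1 - 2 * (m * n))%N; rewrite subnKC //; lia.
have r_lt : (r.+1 <= 2 * m)%N by lia.
have r_sq : (r * r + 4 * m <= 4 * (m * m) + 1)%N.
  have [d mE] : exists d, (2 * m = r.+1 + d)%N by exists (2 * m - r.+1)%N; lia.
  have : (2 * m * (2 * m) = (r.+1 + d) * (r.+1 + d))%N by rewrite mE.
  lia.
have : (4 * m * p < 4 * m * (n * (m * n + r) + 2))%N.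
  by move: sq; rewrite rE -mulnn; lia.
rewrite ltn_pmul2l ?muln_gt0 ?m_gt0 // => lt_p.
have n_gt0 : (0 < n)%N by case: (n) lt_p => //; lia.
have aE : (a.-1 = (m * n + r) + m * n.-1)%N.
  by rewrite -[n.-1]subn1 mulnBr muln1; have := leq_pmulr m n_gt0; lia.
by rewrite aE [(n * (_ + _))%N]mulnDr mulnCA leq_add2r; lia.
Qed.

Theorem theorem1p4 (R : realType) (p : nat) (hp : prime p)
    (m : nat) (hm : (1 <= m)%N)
    (S : {set 'F_p}) (hS : #|S| = m)
    (A : {set 'F_p})
    (hA : Num.sqrt (4 * m%:R * p%:R + 4 * m%:R * (m%:R - 3) + 2) - m%:R + 1
            <= #|A|%:R :> R)
    (n : nat)
    (hn : n%:Z = Num.floor ((#|A|%:R - 1 + m%:R) / (2 * m%:R) : R))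
    (x : 'F_p) :
  exists a : 'I_n -> 'F_p,
    [/\ forall i : 'I_n, a i \in A,
        forall i j : 'I_n, i != j -> a i - a j \notin S
      & \sum_(i < n) a i = x].
Proof.
have card_le (X : {set 'F_p}) : (#|X| <= p)%N.
  by rewrite -[leqRHS](card_Fp hp) max_card.
have le_mp : (m <= p)%N by rewrite -hS card_le.
have [] := size_condition (prime_gt1 hp) hm le_mp (card_le A) hA hn.
move=> lt_mn le_A; exact: (restricted_sums_cover hp hS hm lt_mn le_A x).
Qed.
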